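(* For each integer $k \geq 1$, the pathological triangulation $\mathcal{X}_k$ (which has size $n=4k$) has precisely $\sigma = 17^k + k$ vertex normal surfaces.
   Context: Triangulations: a collection of $n$ tetrahedra (the size is $n$), some or all of whose $4n$ triangular faces are affinely identified in pairs; faces of the same tetrahedron may be identified, and several vertices or edges of the same tetrahedron may become identified. A face gluing written $xyz \to x'y'z'$ maps vertices in the listed order. Unidentified faces are boundary faces. 4-block: the triangulation with boundary built from four tetrahedra $\Delta_1,\Delta_2,\Delta_3,\Delta_4$ with vertices $0,1,2,3$; $a,b,c,d$; $e,f,g,h$; and $e',f',g',h'$ respectively, as follows. (1) Fold together two faces of $\Delta_1$: $012 \to 013$. (2) Wrap $\Delta_2$ around the remaining two faces of $\Delta_1$: $abc \to 230$ and $abd \to 231$. This gives a triangular pillow with three vertices, three boundary edges, two internal edges, and the two boundary faces $acd$, $bcd$. (3) Fold together two faces of $\Delta_3$, via $efg \to efh$, and two faces of $\Delta_4$, via $e'f'g' \to e'f'h'$. (4) Glue the pillow to $\Delta_3$ and $\Delta_4$: $acd \to geh$ and $bcd \to g'e'h'$. The two boundary faces of the 4-block are $fgh$ and $f'g'h'$. There are three boundary vertices: $P$ (the class of $g,h,g',h'$), $R$ (the class of $f$) and $Q$ (the class of $f'$); there is one internal vertex (the class of $c,e,e'$). Pathological triangulation $\mathcal{X}_k$: take $k$ distinct 4-blocks $\mathcal{B}_1,\ldots,\mathcal{B}_k$, and put $\mathcal{B}_{k+1}=\mathcal{B}_1$. For each $i=1,\ldots,k$, glue the boundary face $fgh$ of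 $\mathcal{B}_i$ (with vertices $R_i,P_i,P_i$) to the boundary face $f'g'h'$ of $\mathcal{B}_{i+1}$ (with vertices $Q_{i+1},P_{i+1},P_{i+1}$) by $fgh \to g'h'f'$. This is a twisted gluing mapping $R_i$ to $P_{i+1}$ and one of the corners at $P_i$ to $Q_{i+1}$, and it preserves orientation. Normal surfaces: in each tetrahedron there are four types of normal triangle (one for each vertex $v$, separating $v$ from the other three vertices) and three types of normal quadrilateral (one for each way of splitting the four vertices into two pairs, separating the two pairs). Use coordinates in $\mathbb{R}^{7n}$ indexed by these $7n$ types. The matching equations are: for each pair of identified faces $F \leftrightarrow F'$ and each vertex $v$ of $F$, corresponding to the vertex $v'$ of $F'$, let $\Delta,\Delta'$ be the tetrahedra containing $F,F'$ on the two sides of the gluing. Then $t+q = t'+q'$, where $t$ is the coordinate of the triangle type at $v$ in $\Delta$, $q$ is the coordinate of the quadrilateral type in $\Delta$ that pairs $v$ with the vertex of $\Delta$ opposite $F$, and $t',q'$ are defined likewise from $v',F',\Delta'$. The quadrilateral constraints require that, for each tetrahedron, at most one of its three quadrilateral coordinates is non-zero. The projective solution space is the polytope in $\mathbb{R}^{7n}$ obtained as the cross-section $\sum_i x_i = 1$ of the cone of non-negative vectors satisfying the matching equations. The vertex normal surfaces are in bijection with the vertices of this polytope that satisfy the quadrilateral constraints, and $\sigma$ denotes their number. *)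

(* Defs.v *)
From mathcomp Require Import all_boot all_order all_algebra.
From mathcomp Require Import boolp classical_sets cardinality reals.

Set Implicit Arguments.
Unset Strict Implicit.
Unset Printing Implicit Defensive.

Import Order.TTheory GRing.Theory Num.Theory.

Local Open Scope classical_set_scope.
Local Open Scope ring_scope.

(* A triangular face of a tetrahedron in T, with its vertices listed in order. *)
Definition face (T : Type) : Type := (T * 3.-tuple 'I_4)%type.

Definition mkface (T : Type) (D : T) (x y z : 'I_4) : face T :=
  (D, [tuple x; y; z]).

(* (F, F') is the affine identification F -> F' that maps the i-th listed
   vertex of F to the i-th listed vertex of F'. *)
Definition gluing (T : Type) : Type := (face T * face T)%type.

(* The vertex labels of a tetrahedron sum to 0 + 1 + 2 + 3 = 6. *)
Definition opposite (f : 3.-tuple 'I_4) : 'I_4 :=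
  inZp (6 - sumn [seq val v | v <- f])%N.

Lemma oppositeP (f : 3.-tuple 'I_4) (v : 'I_4) :
  uniq f -> (v == opposite f) = (v \notin f).
Proof.
case: f => -[|x [|y [|z []]]] //= i; rewrite /opposite !inE /= => {i}.
by case: x => -[|[|[|[|?]]]] ?; case: y => -[|[|[|[|?]]]] ?;
  case: z => -[|[|[|[|?]]]] ?; case: v => -[|[|[|[|?]]]] ?.
Qed.

Definition glued_faces (T : Type) (gs : seq (gluing T)) : seq (face T) :=
  flatten [seq [:: g.1; g.2] | g <- gs].

(* Each listed face has three distinct vertices, and no face of a tetrahedron,
   as named by its opposite vertex, is used twice. *)
Definition pairs_faces (T : eqType) (gs : seq (gluing T)) : bool :=
  all (fun F : face T => uniq F.2) (glued_faces gs) &&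
  uniq [seq (F.1, opposite F.2) | F <- glued_faces gs].

Record triangulation := Triangulation {
  tet : finType;
  gluings : seq (gluing tet);
  gluingsP : pairs_faces gluings }.

Definition tri_size (X : triangulation) : nat := #|tet X|.

(* In (D, s), s = inl v is the triangle type at v, and s = inr q the
   quadrilateral type separating {0, q + 1} from the other two vertices. *)
Notation normal_disc T := (T * ('I_4 + 'I_3))%type.

Definition triangle_type (T : Type) (D : T) (v : 'I_4) : normal_disc T :=
  (D, inl v).
Definition quad_type (T : Type) (D : T) (q : 'I_3) : normal_disc T :=
  (D, inr q).

(* The quadrilateral type that pairs the distinct vertices u and v. *)
Definition quad_pairing (u v : 'I_4) : 'I_3 :=
  match val u, val v with
  | 0, 1 | 1, 0 | 2, 3 | 3, 2 => @Ordinal 3 0 isT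
  | 0, 2 | 2, 0 | 1, 3 | 3, 1 => @Ordinal 3 1 isT
  | _, _ => @Ordinal 3 2 isT
  end%N.

Lemma quad_pairingP (u v : 'I_4) (q : 'I_3) : u != v ->
  (q == quad_pairing u v) =
  ((u \in [set ord0; lift ord0 q]%SET) == (v \in [set ord0; lift ord0 q]%SET)).
Proof.
rewrite !inE.
by case: u => -[|[|[|[|?]]]] ?; case: v => -[|[|[|[|?]]]] ?;
  case: q => -[|[|[|?]]] ?.
Qed.

Lemma card_normal_disc (T : finType) : #|{: normal_disc T}| = (7 * #|T|)%N.
Proof. by rewrite card_prod card_sum !card_ord mulnC. Qed.

Definition extreme_point (R : numDomainType) (E : lmodType R) (A : set E)
    (x : E) : Prop :=
  A x /\ forall (y z : E) (t : R), A y -> A z -> 0 < t < 1 ->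
           x = t *: y + (1 - t) *: z -> y = z.

Section NormalSurfaces.
Variables (R : realType) (X : triangulation).

Local Notation normal_coordinates := {ffun normal_disc (tet X) -> R^o}.

Implicit Types x : normal_coordinates.

(* The number of discs of x that meet F in a normal arc around the i-th listed
   vertex of F. *)
Definition arc_count x (F : face (tet X)) (i : 'I_3) : R :=
  let v := tnth F.2 i in
  x (triangle_type F.1 v) + x (quad_type F.1 (quad_pairing v (opposite F.2))).

Definition matching_equations x : Prop :=
  forall (g : gluing (tet X)) (i : 'I_3), g \in gluings X ->
    arc_count x g.1 i = arc_count x g.2 i.

Definition quad_constraints x : Prop :=
  forall (D : tet X) (q q' : 'I_3),
    x (quad_type D q) != 0 -> x (quad_type D q') != 0 -> q = q'.

Definition projective_solution_space : set normal_coordinates :=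
  [set x : normal_coordinates |
   [/\ forall s, 0 <= x s, matching_equations x & \sum_s x s = 1]].

Definition vertex_normal_surfaces : set normal_coordinates :=
  [set x : normal_coordinates |
   extreme_point projective_solution_space x /\ quad_constraints x].

End NormalSurfaces.
Arguments projective_solution_space : clear implicits.
Arguments vertex_normal_surfaces : clear implicits.

Definition i0 : 'I_4 := @Ordinal 4 0 isT.
Definition i1 : 'I_4 := @Ordinal 4 1 isT.
Definition i2 : 'I_4 := @Ordinal 4 2 isT.
Definition i3 : 'I_4 := @Ordinal 4 3 isT.

Section FourBlock.

Local Notation Delta1 := i0.
Local Notation Delta2 := i1.
Local Notation Delta3 := i2.
Local Notation Delta4 := i3.
Local Notation a := i0.
Local Notation b := i1.
Local Notation c := i2.
Local Notation d := i3.
Local Notation e := i0.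
Local Notation f := i1.
Local Notation g := i2.
Local Notation h := i3.
Local Notation e' := i0.
Local Notation f' := i1.
Local Notation g' := i2.
Local Notation h' := i3.

Definition block_gluings : seq (gluing 'I_4) := [::
  (mkface Delta1 i0 i1 i2, mkface Delta1 i0 i1 i3);
  (mkface Delta2 a b c,    mkface Delta1 i2 i3 i0);
  (mkface Delta2 a b d,    mkface Delta1 i2 i3 i1);
  (mkface Delta3 e f g,    mkface Delta3 e f h);
  (mkface Delta4 e' f' g', mkface Delta4 e' f' h');
  (mkface Delta2 a c d,    mkface Delta3 g e h);
  (mkface Delta2 b c d,    mkface Delta4 g' e' h')].

Lemma block_gluingsP : pairs_faces block_gluings.
Proof. by []. Qed.

Definition four_block : triangulation := Triangulation block_gluingsP.

Variable k : nat.

(* (i, D) is the tetrahedron D of the i-th 4-block. *)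
Definition copy_face (i : 'I_k) (F : face (tet four_block)) :
  face ('I_k * tet four_block) := ((i, F.1), F.2).

Definition copy_gluing (i : 'I_k) (G : gluing (tet four_block)) :
  gluing ('I_k * tet four_block) := (copy_face i G.1, copy_face i G.2).

(* ordS is the cyclic successor on 'I_k. *)
Definition link_gluing (i : 'I_k) : gluing ('I_k * tet four_block) :=
  (copy_face i (mkface Delta3 f g h),
   copy_face (ordS i) (mkface Delta4 g' h' f')).

End FourBlock.

Definition pathological_gluings (k : nat) :
  seq (gluing ('I_k * tet four_block)) :=
  [seq copy_gluing i G | i <- enum 'I_k, G <- gluings four_block] ++
  [seq link_gluing i | i <- enum 'I_k].

Lemma pathological_gluingsP k : pairs_faces (pathological_gluings k).
Proof.
pose key (T : Type) (F : face T) := (F.1, opposite F.2).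
pose kB := map (@key _) (glued_faces block_gluings).
pose up (i : 'I_k) (p : 'I_4 * 'I_4) := ((i, p.1), p.2).
pose p3 := key _ (mkface i2 i1 i2 i3); pose p4 := key _ (mkface i3 i2 i3 i1).
have gcat (T : Type) (s t : seq (gluing T)) :
    glued_faces (s ++ t) = glued_faces s ++ glued_faces t.
  by rewrite /glued_faces map_cat flatten_cat.
have Ecopy s : map (@key _) (glued_faces
    [seq copy_gluing i G | i <- s, G <- block_gluings]) =
    [seq up i p | i <- s, p <- kB].
  by elim: s => //= i s IHs; rewrite -IHs.
have Elink s : perm_eq (map (@key _) (glued_faces [seq link_gluing i | i <- s]))
    (map (fun i : 'I_k => up i p3) s ++
     map (fun i : 'I_k => up (ordS i) p4) s).
  elim: s => // i s IHs.
  change (perm_eq (key _ (link_gluing i).1 :: key _ (link_gluing i).2 ::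
    map (@key _) (glued_faces [seq link_gluing j | j <- s]))
    (key _ (link_gluing i).1 :: map (fun j : 'I_k => up j p3) s ++
      key _ (link_gluing i).2 :: map (fun j : 'I_k => up (ordS j) p4) s)).
  by rewrite perm_cons perm_sym perm_catC /= perm_cons perm_catC perm_sym.
rewrite /pairs_faces; apply/andP; split.
  rewrite /pathological_gluings gcat all_cat; apply/andP; split.
    by elim: (enum 'I_k) => // i s IHs; exact: IHs.
  by elim: (enum 'I_k).
rewrite /pathological_gluings gcat map_cat Ecopy.
have upP i j p q : up i p = up j q -> i = j /\ p = q.
  by case: p q => [D v] [D' v'] [-> -> ->].
rewrite (perm_uniq (perm_cat (perm_refl _) (Elink _))) cat_uniq.
apply/and3P; split.
- apply: allpairs_uniq; [exact: enum_uniq | by [] |].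
  by move=> [i p] [j q] _ _ /= /upP[-> ->].
- apply/hasPn => F; rewrite mem_cat => /orP[] /mapP[i _ ->];
    by apply/negP => /allpairsP[[j p] /= [_ pB /upP[_ pE]]]; rewrite -pE in pB.
- rewrite cat_uniq; apply/and3P; split.
  + by rewrite map_inj_uniq ?enum_uniq // => i j /upP[].
  + apply/hasPn => F /mapP[i _ ->].
    by apply/negP => /mapP[j _ /upP[_]].
  + by rewrite map_inj_uniq ?enum_uniq // => i j /upP[/ordS_inj].
Qed.

Definition pathological (k : nat) : triangulation :=
  Triangulation (pathological_gluingsP k).

(* Main.v *)
Require Import Defs.
From mathcomp Require Import all_boot all_order all_algebra.
From mathcomp Require Import boolp classical_sets functions cardinality reals.
From mathcomp Require Import lra.

Local Open Scope classical_set_scope.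
Local Open Scope card_scope.

(** The quadrilateral constraints make the normal surfaces of the pathological
    triangulation essentially a product over its blocks.

    Folding two faces of a tetrahedron together equates two of its
    quadrilateral coordinates, so the constraints force both to vanish; the
    gluing of the pillow passes this on to Delta2.  In every tetrahedron only
    the quadrilateral type that separates {0, 1} from {2, 3} survives
    (straight_quads).  Inside a block, the matching equations make the numbers
    of arcs at g, h, g' and h' in the boundary faces agree; the twisted gluings
    between the blocks then give every corner of every boundary face of every
    block the same number m of arcs.  Besides m, a solution is determined by
    five independent parameters for each block: the four surviving
    quadrilateral coordinates q1, ..., q4 and the coordinate u of the triangles
    at c in Delta2, near the internal vertex (assemble_params).

    A point of the projective solution space is extreme exactly when it spans
    the solutions whose support lies in its own (extreme_pointP), so the task
    is to list the extreme rays.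

    If m = 0, nonnegativity kills all parameters but the u of each block: the
    extreme rays are the k links of the internal vertices (internal_link).

    If m is scaled to 1, the blocks are independent, and an extreme ray is a
    free choice, in each block, of a vertex of the polyhedron
      0 <= q2 <= 1,  0 <= q3, q4 <= min(1, u),  0 <= q1 <= q2 + min(1, u).
    In a vertex of it q2 and u are 0 or 1, q3 and q4 are 0 or u, q1 is 0 or
    q2 + u, and one of q1, q3, q4 is positive if u = 1, for otherwise u could
    vary alone (rigid_corner); conversely all such points are vertices
    (corner_rigid).  There are 3 of them with u = 0 and 2 * 7 with u = 1, so
    17 in all, which makes 17 ^ k rays with m > 0. *)

(** * Extreme points as solutions of rigid support *)

Section ExtremeRays.

Import Order.TTheory GRing.Theory Num.Theory.
Local Open Scope ring_scope.

Context {R : realType} {X : triangulation}.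
Implicit Types x y d : {ffun normal_disc (tet X) -> R^o}.

Definition supported_on d x := forall s, x s = 0 -> d s = 0.

(** For a nonnegative nonzero solution x, this says that x spans an extreme ray
    of the cone of nonnegative solutions, without reference to any
    normalisation. *)
Definition rigid x := forall d,
  matching_equations d -> supported_on d x -> exists c, d = c *: x.

Definition total x : R := \sum_s x s.

Definition projectivize x := (total x)^-1 *: x.

Lemma totalZ c x : total (c *: x) = c * total x.
Proof. by rewrite /total mulr_sumr; apply: eq_bigr => s _; rewrite ffunE. Qed.

Lemma totalD x y : total (x + y) = total x + total y.
Proof. by rewrite /total -big_split; apply: eq_bigr => s _; rewrite ffunE. Qed.

Lemma matching_equationsZ c {x} :
  matching_equations x -> matching_equations (c *: x).
Proof.
move=> mx g i gX; have := mx g i gX; rewrite /arc_count !ffunE => e.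
by rewrite -!mulrDr; congr (c * _).
Qed.

Lemma matching_equationsD {x y} : matching_equations x ->
  matching_equations y -> matching_equations (x + y).
Proof.
move=> mx my g i gX; have := mx g i gX; have := my g i gX.
rewrite /arc_count !ffunE => e e'.
by rewrite addrACA [RHS]addrACA; congr (_ + _).
Qed.

Lemma small_supported_perturbation {x d} : (forall s, 0 <= x s) ->
  supported_on d x -> exists2 e : R, 0 < e & forall s, e * `|d s| <= x s.
Proof.
move=> x0 dx; pose S : R := 1 + \sum_s `|d s| / x s.
have terms0 s : 0 <= `|d s| / x s :> R by rewrite divr_ge0.
have S0 : 0 < S by rewrite ltr_wpDr // sumr_ge0.
exists S^-1; first by rewrite invr_gt0.
move=> s; have [xs0|xs0] := eqVneq (x s) 0; first by rewrite dx ?normr0 ?mulr0.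
have {}xs0 : 0 < x s by rewrite lt_def xs0 x0.
rewrite ler_pdivrMl // -ler_pdivrMr // /S (bigD1 s) //= addrCA lerDl.
by rewrite addr_ge0 // sumr_ge0.
Qed.

(** The faces of the cone are cut out by coordinate hyperplanes, so moving from
    x in a direction d stays in the cone for small steps both ways exactly when
    d is supported on x.  Only the multiples of x itself are invisible in the
    slice of total 1. *)
Lemma extreme_pointP {x} : projective_solution_space R X x ->
  extreme_point (projective_solution_space R X) x <-> rigid x.
Proof.
move=> Px; have [x0 mx] := Px; rewrite -/(total _) => sx; split.
- move=> [_ ext] d md dx; exists (total d); apply/eqP; rewrite -subr_eq0.
  (* Removing the component along x makes d' a direction within the slice. *)
  set d' := d - _; apply/eqP.
  have md' : matching_equations d'.
    by rewrite /d' -scaleNr; apply: matching_equationsD => //;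
      exact: matching_equationsZ.
  have sd' : total d' = 0.
    by rewrite /d' -scaleNr totalD totalZ sx mulr1 subrr.
  have dx' : supported_on d' x.
    by move=> s xs; rewrite !ffunE (dx s xs) xs scaler0 subr0.
  have [e e0 ed] := small_supported_perturbation x0 dx'.
  have P c : `|c| = e -> projective_solution_space R X (x + c *: d').
    move=> ce; split.
    + move=> s; rewrite ffunE [X in _ + X]ffunE -[X in _ <= X]/(x s + c * d' s).
      by have := ed s; rewrite -ce -normrM ler_norml => /andP[? _]; lra.
    + by apply: matching_equationsD => //; exact: matching_equationsZ.
    + by rewrite -/(total _) totalD totalZ sd' mulr0 addr0.
  have := ext (x + e *: d') (x + (- e) *: d') 2^-1.
  have -> : 2^-1 *: (x + e *: d') + (1 - 2^-1) *: (x + (- e) *: d') = x.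
    apply/ffunP => s; rewrite !ffunE /GRing.scale /=.
    by move: (x s : R) (d' s : R) => a b; lra.
  move=> /(_ (P _ _) (P _ _) _ erefl).
  rewrite normrN gtr0_norm // => /(_ erefl erefl) H.
  have {}H : x + e *: d' = x + (- e) *: d' by apply: H; lra.
  move/addrI/eqP: H; rewrite -subr_eq0 scaleNr opprK -scalerDl scaler_eq0.
  by rewrite gt_eqF ?addr_gt0 //= => /eqP.
- move=> rx; split=> // y z t Py Pz /andP[t0 t1] xE.
  have [y0 my sy] := Py; have [z0 mz sz] := Pz.
  (* A zero coordinate of x is a convex combination of nonnegative ones. *)
  have supp s : x s = 0 -> y s = 0 /\ z s = 0.
    rewrite xE !ffunE /GRing.scale /= => /eqP.
    have t1' : 0 < 1 - t by rewrite subr_gt0.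
    rewrite paddr_eq0; try by apply: mulr_ge0; [exact: ltW|].
    by rewrite !mulf_eq0 (gt_eqF t0) (gt_eqF t1') /= => /andP[/eqP ? /eqP ?].
  have multE (v : {ffun normal_disc (tet X) -> R^o}) : total v = 1 ->
      (exists c, v = c *: x) -> v = x.
    move=> wv [c vE]; move: wv; rewrite vE totalZ sx mulr1 => ->.
    by rewrite scale1r.
  have -> : y = x by apply: (multE _ sy); apply: (rx _ my) => s /supp[].
  by apply/esym/(multE _ sz)/(rx _ mz) => s /supp[].
Qed.

Lemma quad_constraintsZ c {x} : c != 0 ->
  quad_constraints (c *: x) <-> quad_constraints x.
Proof.
move=> c0.
have E s : ((c *: x) s == 0) = (x s == 0).
  by rewrite ffunE scaler_eq0 (negbTE c0).
by split=> qx D q q'; have := qx D q q'; rewrite !E.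
Qed.

Lemma rigidZ c {x} : c != 0 -> rigid (c *: x) <-> rigid x.
Proof.
move=> c0.
have E s : (c *: x) s = 0 <-> x s = 0.
  by rewrite ffunE; split=> [/eqP|->]; rewrite ?scaler0// scaler_eq0 (negbTE c0)
    => /eqP.
split=> rx d md dx.
  have [|e ->] := rx d md; first by move=> s /E; exact: dx.
  by exists (e * c); rewrite scalerA.
have [|e ->] := rx d md; first by move=> s /E; exact: dx.
by exists (e / c); rewrite scalerA mulfVK.
Qed.

Lemma vertex_projectivize {y} : (forall s, 0 <= y s) -> total y != 0 ->
  matching_equations y -> quad_constraints y -> rigid y ->
  vertex_normal_surfaces R X (projectivize y).
Proof.
move=> y0 w0 my qy ry; have w0' := w0; rewrite -invr_eq0 in w0'.
have P : projective_solution_space R X (projectivize y).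
  split; last by rewrite -/(total _) totalZ mulVf.
    move=> s; rewrite ffunE; apply: mulr_ge0 => //.
    by rewrite invr_ge0 sumr_ge0.
  exact: matching_equationsZ.
by split; [apply/(extreme_pointP P)/(rigidZ _ w0')|
  apply/(quad_constraintsZ _ w0')].
Qed.

Lemma projectivize_unique {x y c} : total x = 1 -> x = c *: y ->
  x = projectivize y.
Proof.
move=> wx xE; move: wx; rewrite xE totalZ => e; congr (_ *: y).
apply: (mulIf (x := total y)); last first.
  rewrite e mulVf //; apply/eqP => y0; move: e; rewrite y0 mulr0 => /eqP.
  by rewrite eq_sym oner_eq0.
by apply/eqP => y0; move: e; rewrite y0 mulr0 => /eqP; rewrite eq_sym oner_eq0.
Qed.

End ExtremeRays.

(** * The polyhedron of one block *)

Local Notation params T := (T * T * T * T * T)%type.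
Local Notation qa := (@Ordinal 3 0 isT).
Local Notation qb := (@Ordinal 3 1 isT).
Local Notation qc := (@Ordinal 3 2 isT).

Lemma ord3E (q : 'I_3) : q = qa \/ q = qb \/ q = qc.
Proof.
by case: q => -[|[|[|//]]] H; [left|right; left|right; right]; exact: val_inj.
Qed.

Lemma ord4E (v : 'I_4) : v = i0 \/ v = i1 \/ v = i2 \/ v = i3.
Proof.
by case: v => -[|[|[|[|//]]]] H; [left|right; left|right; right; left|
  right; right; right]; exact: val_inj.
Qed.

Section Block.

Import Order.TTheory GRing.Theory Num.Theory.
Local Open Scope ring_scope.

Context {R : realType}.

(** The disc coordinates of an admissible solution in one block, one row of
    triangle types for each tetrahedron.  Here m is the number of arcs at a
    corner of a boundary face, q1, ..., q4 are the quadrilateral coordinates,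
    and u is the coordinate of the triangle type at c in Delta2. *)
Definition block_disc (m : R) (p : params R) (s : normal_disc 'I_4) : R :=
  let '(q1, q2, q3, q4, u) := p in
  match s.2 with
  | inl v => nth 0 (nth [::]
      [:: [:: u + q2 - q1; m + q2 - q1; m - q2; m - q2];
          [:: m - q2; m - q2; u; m];
          [:: u - q3; m - q3; m; m];
          [:: u - q4; m - q4; m; m]] s.1) v
  | inr q => if q == qa then nth 0 [:: q1; q2; q3; q4] s.1 else 0
  end.

(** The vertices of the polyhedron m = 1 are coded by the parameters that do not
    vanish: q3 and q4 need u because they are at most u, q1 needs u or q2
    because it is at most u + q2, and u needs one of q1, q3, q4 because it is
    otherwise free to grow. *)
Definition corner_pattern (c : params bool) : bool :=
  let '(b1, b2, b3, b4, v) := c in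
  [&& b3 || b4 ==> v, b1 ==> b2 || v & v ==> [|| b1, b3 | b4]].

Lemma card_corner_pattern : #|{: {c | corner_pattern c}}| = 17%N.
Proof.
rewrite card_sig cardE size_filter -enumT.
(* Unlock the enumerations of the four nested products and of bool. *)
by do 5 rewrite ?enumT ?unlock /= /prod_enum.
Qed.

Definition corner (c : params bool) : params R :=
  let '(b1, b2, b3, b4, v) := c in
  (b1%:R * (v%:R + b2%:R), b2%:R, b3%:R, b4%:R, v%:R).

Definition scale_params (a : R) (p : params R) : params R :=
  let '(q1, q2, q3, q4, u) := p in (a * q1, a * q2, a * q3, a * q4, a * u).

Lemma block_discZ a m p s :
  block_disc (a * m) (scale_params a p) s = a * block_disc m p s.
Proof.
case: p => [[[[q1 q2] q3] q4] u]; case: s => D [v|q]; rewrite /block_disc /=.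
  by case: (ord4E D) => [->|[->|[->|->]]]; case: (ord4E v) => [->|[->|[->|->]]];
    rewrite /= -?mulrDr -?mulrBr.
by case: (ord4E D) => [->|[->|[->|->]]]; case: ifP => //=; rewrite mulr0.
Qed.

Lemma corner_ge0 c s : corner_pattern c -> 0 <= block_disc 1 (corner c) s.
Proof.
case: c => [[[[b1 b2] b3] b4] v] /and3P[b34 b1v _].
have b01 (b : bool) : 0 <= (b%:R : R) <= 1 by case: b; rewrite /= ?lexx ?ler01.
have /andP[b20 b21] := b01 b2; have /andP[b30 _] := b01 b3.
have /andP[b40 _] := b01 b4; have /andP[v0 v1] := b01 v.
have b3v : b3%:R <= v%:R :> R.
  by rewrite ler_nat; move/implyP: b34; case: (b3) => //= ->.
have b4v : b4%:R <= v%:R :> R.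
  by rewrite ler_nat; move/implyP: b34; case: (b4) => //= ->; rewrite ?orbT.
have q0 : 0 <= b1%:R * (v%:R + b2%:R) :> R by rewrite mulr_ge0 ?addr_ge0 ?ler0n.
have q1 : b1%:R * (v%:R + b2%:R) <= v%:R + b2%:R :> R.
  by rewrite ler_piMl ?addr_ge0 //; have /andP[] := b01 b1.
rewrite /corner /block_disc.
move: (b1%:R * _) q0 q1 => q1 q10 q1l; case: s => D [w|q] /=; last first.
  by case: ifP => // _; case: (ord4E D) => [->|[->|[->|->]]] /=.
by case: (ord4E D) => [->|[->|[->|->]]];
  case: (ord4E w) => [->|[->|[->|->]]] /=; lra.
Qed.

(** Each parameter of a corner is fixed by coordinates that vanish there.  The
    delicate one is u: it is tied to q3 or q4 by a vanishing triangle at e or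
    e' or, when b1 and v hold, to m by the two vanishing triangles at 0 and 1
    in Delta1. *)
Lemma corner_rigid c a p : corner_pattern c ->
  (forall s, block_disc 1 (corner c) s = 0 -> block_disc a p s = 0) ->
  p = scale_params a (corner c).
Proof.
case: c p => [[[[b1 b2] b3] b4] v] [[[[d1 d2] d3] d4] du] /and3P[b34 b1v vb] z.
have e2 : d2 = a * b2%:R.
  by case: b2 {b1v} z => z;
    [move: (z (i1, inl i0) (subrr _))|move: (z (i1, inr qa) erefl)];
    rewrite /= => ?; lra.
have e3 : d3 = a * b3%:R.
  by case: b3 {b34 vb} z => z;
    [move: (z (i2, inl i1) (subrr _))|move: (z (i2, inr qa) erefl)];
    rewrite /= => ?; lra.
have e4 : d4 = a * b4%:R.
  by case: b4 {b34 vb} z => z;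
    [move: (z (i3, inl i1) (subrr _))|move: (z (i3, inr qa) erefl)];
    rewrite /= => ?; lra.
have top : b1 -> d1 = du + d2.
  move=> b1T; have := z (i0, inl i0).
  by rewrite /block_disc /= b1T mul1r subrr => /(_ erefl); lra.
have eu : du = a * v%:R.
  case: v b34 b1v vb z top => [_ _ vb|b34 b1v _] z top; last first.
    have b3F : b3 = false by case: (b3) b34.
    have := z (i2, inl i0); rewrite /block_disc /= b3F subrr => /(_ erefl).
    by rewrite e3 b3F /=; lra.
  have [b3T|b3F] := boolP b3.
    have := z (i2, inl i0); rewrite /block_disc /= b3T subrr => /(_ erefl).
    by rewrite e3 b3T /=; lra.
  have [b4T|b4F] := boolP b4.
    have := z (i3, inl i0); rewrite /block_disc /= b4T subrr => /(_ erefl).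
    by rewrite e4 b4T /=; lra.
  have b1T : b1 by move: vb; rewrite (negbTE b3F) (negbTE b4F) !orbF.
  have := z (i0, inl i1); rewrite /block_disc /= b1T mul1r subrr => /(_ erefl).
  by rewrite (top b1T) /=; lra.
have e1 : d1 = a * (b1%:R * (v%:R + b2%:R)).
  have [b1T|b1F] := boolP b1; first by rewrite top // eu e2 mul1r mulrDr.
  have := z (i0, inr qa); rewrite /block_disc /= (negbTE b1F) mul0r.
  by rewrite mulr0 => /(_ erefl).
by rewrite e1 e2 e3 e4 eu.
Qed.

(** Wherever a parameter lies strictly between its extreme values, moving it,
    together with the parameters that a vanishing coordinate ties to it, keeps
    all vanishing coordinates at 0 and contradicts rigidity. *)
Lemma rigid_corner p : (forall s, 0 <= block_disc 1 p s) ->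
  (forall p' : params R,
     (forall s, block_disc 1 p s = 0 -> block_disc 0 p' s = 0) ->
     p' = (0, 0, 0, 0, 0)) ->
  exists2 c, corner_pattern c & p = corner c.
Proof.
case: p => [[[[q1 q2] q3] q4] u] p0 rig.
have := (p0 (i0, inl i0), p0 (i0, inl i1), p0 (i1, inl i0), p0 (i2, inl i0),
         p0 (i2, inl i1), p0 (i3, inl i0), p0 (i3, inl i1)).
have := (p0 (i0, inr qa), p0 (i1, inr qa), p0 (i2, inr qa), p0 (i3, inr qa)).
rewrite /block_disc /= => -[[[q10 q20] q30] q40].
move=> [[[[[[t0 t1] s0] f0] f1] g0] g1].
(* A direction (d1, ..., du) may not respect all the vanishing coordinates. *)
have {rig} fr (d1 d2 d3 d4 du : R) :
    (q1 = 0 -> d1 = 0) -> (q2 = 0 -> d2 = 0) -> (q3 = 0 -> d3 = 0) ->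
    (q4 = 0 -> d4 = 0) -> (u + q2 - q1 = 0 -> du + d2 - d1 = 0) ->
    (1 + q2 - q1 = 0 -> 0 + d2 - d1 = 0) -> (1 - q2 = 0 -> 0 - d2 = 0) ->
    (1 - q3 = 0 -> 0 - d3 = 0) -> (1 - q4 = 0 -> 0 - d4 = 0) ->
    (u - q3 = 0 -> du - d3 = 0) -> (u - q4 = 0 -> du - d4 = 0) ->
    (u = 0 -> du = 0) -> (d1, d2, d3, d4, du) = (0, 0, 0, 0, 0).
  move=> H1 H2 H3 H4 H5 H6 H7 H8 H9 H10 H11 Hu; apply: rig => -[D [w|q]].
    rewrite /block_disc /=.
    by case: (ord4E D) => [->|[->|[->|->]]];
      case: (ord4E w) => [->|[->|[->|->]]].
  rewrite /block_disc /=; case: ifP => // _.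
  by case: (ord4E D) => [->|[->|[->|->]]].
have {}s0 : q2 <= 1 by rewrite -subr_ge0.
have {}f0 : q3 <= u by rewrite -subr_ge0.
have {}g0 : q4 <= u by rewrite -subr_ge0.
have {}t0 : q1 <= u + q2 by rewrite -subr_ge0.
have {p0 t1 f1 g1} u0 : 0 <= u := le_trans q30 f0.
have n10 : (1 : R) <> 0 by apply/eqP/oner_neq0.
have q2E : q2 = 0 \/ q2 = 1.
  have [|q2n0] := eqVneq q2 0; first by left.
  have [|q2n1] := eqVneq q2 1; first by right.
  have {}q2n0 : 0 < q2 by rewrite lt_def q2n0.
  have {}q2n1 : q2 < 1 by rewrite lt_neqAle q2n1.
  have [q1E|q1n0] := eqVneq q1 0.
    by have [] : (0, 1, 0, 0, 0) = (0, 0, 0, 0, 0) :> params R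
      by apply: fr => ?; lra.
  have {}q1n0 : 0 < q1 by rewrite lt_def q1n0.
  by have [] : (1, 1, 0, 0, 0) = (0, 0, 0, 0, 0) :> params R
    by apply: fr => ?; lra.
have uE : u = 0 \/ u = 1.
  have [|/eqP un0] := eqVneq u 0; first by left.
  have [|/eqP un1] := eqVneq u 1; first by right.
  (* A quadrilateral coordinate equal to u has to move with u. *)
  have tie r : exists dr : R,
      [/\ r = 0 -> dr = 0, 1 - r = 0 -> 0 - dr = 0 & u - r = 0 -> 1 - dr = 0].
    have [->|/eqP rnu] := eqVneq r u.
      by exists 1; split=> // [|_]; [move/subr0_eq/esym|rewrite subrr].
    by exists 0; split=> // [_|/subr0_eq/esym//]; rewrite subrr.
  have [d3 [d30 d31 d3u]] := tie q3; have [d4 [d40 d41 d4u]] := tie q4.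
  have [q1E|q1n] := eqVneq q1 (u + q2).
    by have [] : (1, 0, d3, d4, 1) = (0, 0, 0, 0, 0) :> params R
      by apply: fr => // ?; first [lra | case: un1; lra | case: un0; lra].
  have {}q1n : q1 < u + q2 by rewrite lt_neqAle q1n.
  by have [] : (0, 0, d3, d4, 1) = (0, 0, 0, 0, 0) :> params R
    by apply: fr => // ?; lra.
have mid r : 0 <= r -> r <= u ->
    (0 < r -> r < u -> r < 1 -> False) -> r = 0 \/ r = u.
  move=> r0 ru H; have [|rn0] := eqVneq r 0; first by left.
  have [|rnu] := eqVneq r u; first by right.
  have r1 : r < u by rewrite lt_neqAle rnu.
  by case: H => //; [rewrite lt_def rn0|lra].
have q3E : q3 = 0 \/ q3 = u.
  apply: mid => // r0 ru r1.
  by have [] : (0, 0, 1, 0, 0) = (0, 0, 0, 0, 0) :> params R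
    by apply: fr => // ?; lra.
have q4E : q4 = 0 \/ q4 = u.
  apply: mid => // r0 ru r1.
  by have [] : (0, 0, 0, 1, 0) = (0, 0, 0, 0, 0) :> params R
    by apply: fr => // ?; lra.
have q1E : q1 = 0 \/ q1 = u + q2.
  have [|q1n0] := eqVneq q1 0; first by left.
  have [|q1n] := eqVneq q1 (u + q2); first by right.
  have {}q1n0 : 0 < q1 by rewrite lt_def q1n0.
  have {}q1n : q1 < u + q2 by rewrite lt_neqAle q1n.
  by have [] : (1, 0, 0, 0, 0) = (0, 0, 0, 0, 0) :> params R
    by apply: fr => // ?; lra.
have top : u = 1 -> q1 = 0 -> q3 = 0 -> q4 = 0 -> False.
  move=> u1 q10' q30' q40'.
  by have [] : (0, 0, 0, 0, 1) = (0, 0, 0, 0, 0) :> params R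
    by apply: fr => // ?; lra.
have [v uv] : exists v : bool, u = v%:R.
  by case: uE => ->; [exists false|exists true].
have [b2 q2b] : exists b2 : bool, q2 = b2%:R.
  by case: q2E => ->; [exists false|exists true].
have [b3 b3v q3b] : exists2 b3 : bool, b3 ==> v & q3 = b3%:R.
  by case: q3E => ->; [exists false|exists v; rewrite ?implybb].
have [b4 b4v q4b] : exists2 b4 : bool, b4 ==> v & q4 = b4%:R.
  by case: q4E => ->; [exists false|exists v; rewrite ?implybb].
have [b1 b1v q1b] : exists2 b1 : bool,
    b1 ==> b2 || v & q1 = b1%:R * (v%:R + b2%:R).
  case: q1E => ->; first by exists false; rewrite ?mul0r.
  exists (b2 || v); rewrite ?implybb // uv q2b.
  by case: (b2); case: (v); rewrite ?mul1r //= mul0r addr0.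
exists (b1, b2, b3, b4, v); last by rewrite /corner uv q1b q2b q3b q4b.
apply/and3P; split=> //; first by case: (b3) b3v.
apply/implyP => vT; apply/negPn/negP; rewrite !negb_or => /and3P[b1F b3F b4F].
by apply: top; rewrite ?uv ?vT ?q1b ?q3b ?q4b ?(negbTE b1F) ?(negbTE b3F)
  ?(negbTE b4F) ?mul0r.
Qed.

Lemma corner_inj c c' : corner_pattern c -> corner_pattern c' ->
  corner c = corner c' :> params R -> c = c'.
Proof.
have natI (b b' : bool) : b%:R = b'%:R :> R -> b = b'.
  by move/eqP; rewrite eqr_nat; case: b; case: b'.
case: c c' => [[[[b1 b2] b3] b4] v] [[[[b1' b2'] b3'] b4'] v'].
move=> /and3P[_ b1v _] /and3P[_ b1v' _] [+ /natI E2 /natI E3 /natI E4 /natI Ev].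
subst b2' b3' b4' v'.
have [vb2|] := boolP (b2 || v); last first.
  by move/negbTE=> f; move: b1v b1v'; rewrite f !implybF => /negbTE-> /negbTE->.
move/mulIf => /(_ _)/natI-> //.
by rewrite -natrD pnatr_eq0 addn_eq0; move: vb2; case: (b2); case: (v).
Qed.

(** With m = 0 and no quadrilaterals, a block carries parallel copies of the
    link of its internal vertex. *)
Lemma block_disc_internal (u : R) s :
  block_disc 0 (0, 0, 0, 0, u) s = u * block_disc 0 (0, 0, 0, 0, 1) s.
Proof.
have -> : (0, 0, 0, 0, u) = scale_params u (0, 0, 0, 0, 1).
  by rewrite /= !mulr0 mulr1.
by rewrite -block_discZ mulr0.
Qed.

End Block.

(** * Solutions with a single quadrilateral type per tetrahedron *)

Section Pathological.

Import Order.TTheory GRing.Theory Num.Theory.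
Local Open Scope ring_scope.

Context {R : realType} {k : nat}.
Implicit Types (x y d : {ffun normal_disc (tet (pathological k)) -> R^o}).
Implicit Types (p : 'I_k -> params R) (i j : 'I_k).

Definition assemble m p : {ffun normal_disc (tet (pathological k)) -> R^o} :=
  [ffun s => block_disc m (p s.1.1) (s.1.2, s.2)].

(** In the labels of the four tetrahedra, the type qa separates 01 from 23, ab
    from cd, ef from gh, and e'f' from g'h'. *)
Definition straight x := forall D q, q != qa -> x (quad_type D q) = 0.

(** For straight x, each triangle at d in Delta2 continues across the pillow as
    one triangle at h and one at h', so this counts the arcs at these corners of
    the boundary faces. *)
Definition boundary_arcs x i : R := x (triangle_type (i, i1) i3).

Definition block_params x i : params R :=
  (x (quad_type (i, i0) qa), x (quad_type (i, i1) qa),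
   x (quad_type (i, i2) qa), x (quad_type (i, i3) qa),
   x (triangle_type (i, i1) i2)).

Lemma matching_assemble m p : matching_equations (assemble m p).
Proof.
move=> g i; rewrite mem_cat.
move=> /orP[/allpairsP[[j G] [_ /= GB ->]]|/mapP[j _ ->]];
  rewrite /arc_count !ffunE; case: (p j) => [[[[q1 q2] q3] q4] u]; last first.
  case: (p (ordS j)) => [[[[q1' q2'] q3'] q4'] u'].
  by case: (ord3E i) => [->|[->|->]]; rewrite /block_disc /=; lra.
move: GB; rewrite !inE => GB.
by repeat case/orP: GB => [/eqP->|GB]; last move/eqP: GB => ->;
  case: (ord3E i) => [->|[->|->]]; rewrite /block_disc /=; lra.
Qed.

(** The matching equations at the gluings of block j, followed by those at the
    link to the next block; in the first item, for the folded tetrahedra, the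
    terms common to both sides are cancelled. *)
Lemma block_equations {x} j : matching_equations x ->
  let t D v : R := x (triangle_type (j, D) v) in
  let y D q : R := x (quad_type (j, D) q) in
  [/\ forall D, D \in [:: i0; i2; i3] ->
        y D qb = y D qc /\ t D i2 = t D i3,
      [/\ t i1 i0 + y i1 qc = t i0 i2 + y i0 qc,
          t i1 i1 + y i1 qb = t i0 i3 + y i0 qb &
          t i1 i2 + y i1 qa = t i0 i0 + y i0 qa] /\
      [/\ t i1 i0 + y i1 qb = t i0 i2 + y i0 qb,
          t i1 i1 + y i1 qc = t i0 i3 + y i0 qc &
          t i1 i3 + y i1 qa = t i0 i1 + y i0 qa],
      [/\ t i1 i0 + y i1 qa = t i2 i2 + y i2 qc,
          t i1 i2 + y i1 qc = t i2 i0 + y i2 qa &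
          t i1 i3 + y i1 qb = t i2 i3 + y i2 qb],
      [/\ t i1 i1 + y i1 qa = t i3 i2 + y i3 qc,
          t i1 i2 + y i1 qb = t i3 i0 + y i3 qa &
          t i1 i3 + y i1 qc = t i3 i3 + y i3 qb] &
      [/\ t i2 i1 + y i2 qa =
            x (triangle_type (ordS j, i3) i2) + x (quad_type (ordS j, i3) qb),
          t i2 i2 + y i2 qb =
            x (triangle_type (ordS j, i3) i3) + x (quad_type (ordS j, i3) qc) &
          t i2 i3 + y i2 qc =
            x (triangle_type (ordS j, i3) i1) + x (quad_type (ordS j, i3) qa)]].
Proof.
move=> mx t y.
have E n (a : 'I_3) : (n < 7)%N ->
    let G := nth (mkface i0 i0 i0 i0, mkface i0 i0 i0 i0) block_gluings n in
    arc_count x (copy_gluing j G).1 a = arc_count x (copy_gluing j G).2 a.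
  move=> n7 G; apply: mx; rewrite mem_cat; apply/orP; left.
  by apply/allpairsP; exists (j, G); rewrite mem_enum mem_nth.
have L (a : 'I_3) :
    arc_count x (link_gluing j).1 a = arc_count x (link_gluing j).2 a.
  apply: mx; rewrite mem_cat; apply/orP; right.
  by apply/map_f; rewrite mem_enum.
have fold D n : (n < 7)%N ->
    nth (mkface i0 i0 i0 i0, mkface i0 i0 i0 i0) block_gluings n =
    (mkface D i0 i1 i2, mkface D i0 i1 i3) ->
    y D qb = y D qc /\ t D i2 = t D i3.
  move=> n7 nE; split.
    by apply: (addrI (t D i0)); have := E n qa n7; rewrite nE => /esym.
  by apply: (addIr (y D qa)); have := E n qc n7; rewrite nE.
split.
- move=> D; rewrite !inE => /or3P[] /eqP->; [exact: (fold _ 0%N)|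
    exact: (fold _ 3%N)|exact: (fold _ 4%N)].
- by split; split; [exact: (E 1%N qa)|exact: (E 1%N qb)|exact: (E 1%N qc)|
    exact: (E 2%N qa)|exact: (E 2%N qb)|exact: (E 2%N qc)].
- by split; [exact: (E 5%N qa)|exact: (E 5%N qb)|exact: (E 5%N qc)].
- by split; [exact: (E 6%N qa)|exact: (E 6%N qb)|exact: (E 6%N qc)].
- by split; [exact: (L qa)|exact: (L qb)|exact: (L qc)].
Qed.

(** Folding equates the types qb and qc in Delta1, Delta3 and Delta4, and the
    constraints allow at most one of them.  With both absent from Delta1, the
    two faces of Delta2 glued to it equate its own types qb and qc. *)
Lemma straight_quads x : matching_equations x -> quad_constraints x ->
  straight x.
Proof.
move=> mx qx [j D] q.
have [fold [[e1 e2 e3] [e4 e5 e6]] _ _ _] := block_equations j mx.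
have F D' : D' \in [:: i0; i2; i3] ->
    (x (quad_type (j, D') qb) = 0 :> R) /\ (x (quad_type (j, D') qc) = 0 :> R).
  move=> /fold[qE _].
  suff: x (quad_type (j, D') qb) = 0 by move=> H; rewrite -qE.
  apply/eqP/negPn/negP => q0; have := qx (j, D') qb qc q0.
  by rewrite -qE => /(_ q0).
have [z1 z2] := F i0 isT.
have B : x (quad_type (j, i1) qb) = x (quad_type (j, i1) qc).
  by move: e1 e4; rewrite z1 z2 => <- /addrI.
have [z1' z2'] : x (quad_type (j, i1) qb) = 0 /\ x (quad_type (j, i1) qc) = 0.
  suff: x (quad_type (j, i1) qb) = 0 by move=> H; rewrite -B.
  apply/eqP/negPn/negP => q0; have := qx (j, i1) qb qc q0.
  by rewrite -B => /(_ q0).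
have [z3 z4] := F i2 isT; have [z5 z6] := F i3 isT.
by case: (ord3E q) => [->|[->|->]] //; case: (ord4E D) => [->|[->|[->|->]]].
Qed.

Lemma ordS_invariant {T} {f : 'I_k -> T} : (forall i, f (ordS i) = f i) ->
  forall i j, f i = f j.
Proof.
move=> fS; suff H n (nk : (n < k)%N) (k0 : (0 < k)%N) :
    f (Ordinal nk) = f (Ordinal k0).
  move=> [a ak] [b bk]; have k0 := leq_ltn_trans (leq0n a) ak.
  by rewrite (H a _ k0) (H b _ k0).
elim: n nk => [|n IHn] nk; first by congr f; exact: val_inj.
rewrite -(IHn (ltnW nk)) -[RHS]fS; congr f; apply: val_inj.
by rewrite /= modn_small.
Qed.

Lemma boundary_triangles {x} i : matching_equations x -> straight x ->
  [/\ x (triangle_type (i, i2) i2) = boundary_arcs x i,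
      x (triangle_type (i, i2) i3) = boundary_arcs x i,
      x (triangle_type (i, i3) i2) = boundary_arcs x i &
      x (triangle_type (i, i3) i3) = boundary_arcs x i].
Proof.
move=> mx sx; have [fold _ [_ _ e] [_ _ e'] _] := block_equations i mx.
have [_ ->] := fold i2 isT; have [_ ->] := fold i3 isT.
by move: e e'; rewrite !sx // !addr0 => <- <-.
Qed.

(** The twisted gluing maps g to h', so it identifies the arc counts of
    consecutive blocks, and the blocks form a single cycle. *)
Lemma boundary_arcs_const {x} i j : matching_equations x -> straight x ->
  boundary_arcs x i = boundary_arcs x j.
Proof.
move=> mx sx; apply: ordS_invariant => l.
have [_ _ _ _ [_ e _]] := block_equations l mx.
have [t2 _ _ _] := boundary_triangles l mx sx.
have [_ _ _ t3] := boundary_triangles (ordS l) mx sx.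
by move: e; rewrite t2 t3 !sx // !addr0.
Qed.

(** Most coordinates are read off the matching equations inside block j.  The
    triangles at f and f' are not: the link sends f to g' in the next block and
    h to f' from the previous one, and this sets the arc counts at f and f' to
    the common value. *)
Lemma assemble_params {x} i : matching_equations x -> straight x ->
  x = assemble (boundary_arcs x i) (block_params x).
Proof.
move=> mx sx; apply/ffunP => -[[j D] s]; rewrite ffunE.
rewrite (boundary_arcs_const i j) //.
have [sb sc] :
    (forall D, x (quad_type D qb) = 0) /\ (forall D, x (quad_type D qc) = 0).
  by split=> D'; exact: sx.
have [fold [[e1 e2 e3] [_ _ e4]] [e5 e6 _] [_ e7 _] [e8 _ _]] :=
  block_equations j mx.
have [t1 t2 t3 t4] := boundary_triangles j mx sx.
have [_ _ t5 _] := boundary_triangles (ordS j) mx sx.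
have [_ t6 _ _] := boundary_triangles (ord_pred j) mx sx.
have [_ _ _ _ [_ _ e9]] := block_equations (ord_pred j) mx.
have [_ f0] := fold i0 isT.
rewrite ord_predK t6 (boundary_arcs_const _ j) // in e9.
rewrite t5 (boundary_arcs_const _ j) // in e8.
rewrite t1 ?sb ?sc ?addr0 in e5.
rewrite !sb !sc !addr0 in e1 e2 e3 e4 e6 e7 e8 e9.
case: s => [v|q]; last first.
  case: (ord3E q) => [->|[->|->]]; rewrite /block_disc /=; [|by rewrite sx..].
  by case: (ord4E D) => [->|[->|[->|->]]].
rewrite /block_disc /block_params.
have e10 : x (triangle_type (j, i1) i3) = boundary_arcs x j by [].
move: (boundary_arcs x j) e5 e8 e9 e10 t1 t2 t3 t4 => m *.
by case: (ord4E D) => [->|[->|[->|->]]]; case: (ord4E v) => [->|[->|[->|->]]];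
  rewrite /= -?/(triangle_type _ _); lra.
Qed.

(** * The extreme rays *)

Lemma assembleZ a m p :
  assemble (a * m) (fun i => scale_params a (p i)) = a *: assemble m p.
Proof. by apply/ffunP => s; rewrite !ffunE block_discZ. Qed.

Lemma straight_assemble m p : straight (assemble m p).
Proof.
move=> D q qn0; rewrite ffunE /block_disc /= (negbTE qn0).
by case: (p _) => [[[[q1 q2] q3] q4] u].
Qed.

Lemma straight_quad_constraints x : straight x -> quad_constraints x.
Proof.
move=> sx D q q' qn0 q'n0.
have E r : x (quad_type D r) != 0 -> r = qa.
  by move=> rn0; apply: contraNeq rn0 => /sx->.
by rewrite (E q qn0) (E q' q'n0).
Qed.

Lemma straight_supported {d x} : supported_on d x -> straight x -> straight d.
Proof. by move=> dx sx D q /sx-/(_ D)/dx. Qed.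

Lemma boundary_arcs_assemble m p i : boundary_arcs (assemble m p) i = m.
Proof.
by rewrite /boundary_arcs ffunE /block_disc /=; case: (p i) => [[[[]]]].
Qed.

Lemma block_params_assemble m p i : block_params (assemble m p) i = p i.
Proof.
by rewrite /block_params !ffunE /block_disc /=; case: (p i) => [[[[]]]].
Qed.

Lemma boundary_arcsZ a x i :
  boundary_arcs (a *: x) i = a * boundary_arcs x i.
Proof. by rewrite /boundary_arcs ffunE. Qed.

Definition corner_surface (c : 'I_k -> params bool) :=
  assemble 1 (fun i => corner (c i) : params R).

Definition internal_link i :=
  assemble 0 (fun j => (0, 0, 0, 0, (j == i)%:R) : params R).

(** A solution supported on this one is again assembled from block parameters,
    and in each block corner_rigid makes them proportional to the corner, with
    the common arc count as the factor. *)
Lemma corner_surface_rigid c : (0 < k)%N -> (forall i, corner_pattern (c i)) ->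
  rigid (corner_surface c).
Proof.
move=> k0 cP d md dx; pose i := Ordinal k0.
have sd := straight_supported dx (straight_assemble _ _).
have dE := assemble_params i md sd.
exists (boundary_arcs d i); rewrite {1}dE -assembleZ mulr1.
congr assemble; apply: funext => j; apply: corner_rigid => // s s0.
have := dx (j, s.1, s.2).
rewrite {1}dE /corner_surface !ffunE /=; case: s s0 => D s s0; exact.
Qed.

Lemma internal_link_rigid i : rigid (internal_link i).
Proof.
move=> d md dx.
have sd := straight_supported dx (straight_assemble _ _).
have dE := assemble_params i md sd.
have d0 s : internal_link i s = 0 -> d s = 0 by exact: dx.
exists (d (triangle_type (i, i1) i2)); rewrite {1}dE.
have -> : boundary_arcs d i = d (triangle_type (i, i1) i2) * 0.
  by rewrite mulr0 /boundary_arcs d0 // ffunE.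
rewrite -assembleZ; congr assemble; apply: funext => j.
rewrite /block_params /= !mulr0.
have [->|ji] := eqVneq j i; rewrite ?mulr1 ?mulr0.
  by rewrite !(d0 (quad_type _ _)) // ffunE.
rewrite !(d0 (quad_type _ _)) ?ffunE // (d0 (triangle_type (j, i1) i2)) //.
by rewrite ffunE /block_disc /= (negbTE ji).
Qed.

Lemma internal_link_ge0 i s : 0 <= internal_link i s.
Proof.
rewrite ffunE /block_disc; case: s => -[j D] [v|q] /=.
  by case: (ord4E D) => [->|[->|[->|->]]]; case: (ord4E v) => [->|[->|[->|->]]];
    rewrite /= ?subr0 ?addr0 ?ler0n.
by case: (ord4E D) => [->|[->|[->|->]]]; case: ifP.
Qed.

Definition extreme_ray (t : {ffun 'I_k -> {c | corner_pattern c}} + 'I_k) :=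
  match t with
  | inl c => corner_surface (fun i => val (c i))
  | inr i => internal_link i
  end.

Lemma extreme_ray_total t : (0 < k)%N -> total (extreme_ray t) != 0.
Proof.
move=> k0; have ge0 s : 0 <= extreme_ray t s.
  case: t s => [c|i] s; last exact: internal_link_ge0.
  by rewrite ffunE corner_ge0 // (valP (c _)).
rewrite /total psumr_eq0 //; apply/allPn.
case: t {ge0} => [c|i] /=.
  exists (triangle_type (Ordinal k0, i1) i3); rewrite ?mem_index_enum //.
  rewrite ffunE /block_disc /corner /=.
  by case: (val _) => [[[[]]]] *; exact: oner_neq0.
exists (triangle_type (i, i1) i2); rewrite ?mem_index_enum //.
by rewrite ffunE /block_disc /= eqxx oner_neq0.
Qed.

Lemma extreme_ray_vertex t : (0 < k)%N ->
  vertex_normal_surfaces R (pathological k) (projectivize (extreme_ray t)).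
Proof.
move=> k0; apply: vertex_projectivize.
- case: t => [c|i] s; last exact: internal_link_ge0.
  by rewrite ffunE corner_ge0 // (valP (c _)).
- exact: extreme_ray_total.
- by case: t => [c|i]; exact: matching_assemble.
- by case: t => [c|i]; apply: straight_quad_constraints;
    exact: straight_assemble.
- case: t => [c|i]; last exact: internal_link_rigid.
  by apply: corner_surface_rigid => // i; exact: (valP (c i)).
Qed.

(** Equal projectivizations are proportional, and the ratio of the arc counts
    tells the two kinds of ray apart; once the factor is known, the block
    parameters identify the ray. *)
Lemma projectivize_extreme_ray_inj : (0 < k)%N ->
  injective (fun t => projectivize (extreme_ray t)).
Proof.
move=> k0 t t' tt'.
have [a tE] : exists a, extreme_ray t = a *: extreme_ray t'.
  exists (total (extreme_ray t) * (total (extreme_ray t'))^-1).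
  rewrite -scalerA -[X in _ = _ *: X]tt' scalerA mulfV ?scale1r //.
  exact: extreme_ray_total.
have {tt'} B j :
    boundary_arcs (extreme_ray t) j = a * boundary_arcs (extreme_ray t') j.
  by rewrite tE boundary_arcsZ.
have U i : internal_link i (triangle_type (i, i1) i2) = 1.
  by rewrite ffunE /block_disc /= eqxx.
case: t t' tE B => [c|i] [c'|i'] /= tE B.
- move: (B (Ordinal k0)); rewrite !boundary_arcs_assemble mulr1 => a1.
  rewrite -a1 scale1r in tE; congr inl; apply/ffunP => j.
  apply/val_inj/(@corner_inj R); try exact: (valP (_ j)).
  have := congr1 (fun x => block_params x j) tE.
  by rewrite !block_params_assemble.
- move: (B (Ordinal k0)); rewrite !boundary_arcs_assemble mulr0 => /eqP.
  by rewrite oner_eq0.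
- move: (B (Ordinal k0)); rewrite !boundary_arcs_assemble mulr1 => a0.
  have := U i; rewrite tE -a0 scale0r ffunE => /esym/eqP.
  by rewrite oner_eq0.
- have := U i; rewrite tE ffunE [internal_link _ _]ffunE /block_disc /=.
  have [->//|_] := eqVneq i i'; rewrite scaler0 => /esym/eqP.
  by rewrite oner_eq0.
Qed.

(** If the arc count m vanishes, then x has the link of some internal vertex in
    its support, so rigidity makes it a multiple of that link.  Otherwise
    scale to m = 1: a motion of a single block is a solution supported on x
    with m = 0, so it cannot be a nonzero multiple of x, and rigid_corner
    applies to each block. *)
Lemma vertex_extreme_ray {x} : (0 < k)%N ->
  vertex_normal_surfaces R (pathological k) x ->
  exists t, x = projectivize (extreme_ray t).
Proof.
move=> k0 [ext qx]; have [[x0 mx x1] _] := ext.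
have {ext} rx : rigid x by case: (ext) => Px _; apply/(extreme_pointP Px).
have {qx} sx := straight_quads _ mx qx.
have xE := assemble_params (Ordinal k0) mx sx.
have x0' j s :
    0 <= block_disc (boundary_arcs x (Ordinal k0)) (block_params x j) s.
  by have := x0 ((j, s.1), s.2); rewrite {1}xE ffunE; case: s.
have [mE|mn0] := eqVneq (boundary_arcs x (Ordinal k0)) 0.
  rewrite mE in xE x0'.
  pose u j : R := x (triangle_type (j, i1) i2).
  have W j : block_params x j = (0, 0, 0, 0, u j).
    have := (x0' j (i0, inl i1), x0' j (i1, inl i0),
             x0' j (i2, inl i1), x0' j (i3, inl i1)).
    have := (x0' j (i0, inr qa), x0' j (i1, inr qa),
             x0' j (i2, inr qa), x0' j (i3, inr qa)).
    rewrite /block_disc /block_params -/(u j) /=.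
    move: (x (quad_type (j, i0) qa) : R) (x (quad_type (j, i1) qa) : R).
    move: (x (quad_type (j, i2) qa) : R) (x (quad_type (j, i3) qa) : R).
    move=> q3 q4 q1 q2 [[[q10 q20] q30] q40] [[[t1 s0] f1] g1].
    by congr (_, _, _, _, _); lra.
  have {}xE : x = assemble 0 (fun j => (0, 0, 0, 0, u j)).
    by rewrite {1}xE; congr assemble; exact: funext.
  have [i ui0] : exists i, u i != 0.
    apply: contrapT => /forallNP un0; move/eqP: x1.
    rewrite big1 ?(eq_sym 0) ?oner_eq0 //.
    move=> s _; rewrite xE ffunE.
    have /negP/negPn/eqP-> := un0 s.1.1.
    by rewrite block_disc_internal mul0r.
  have [|c iE] := rx (internal_link i) (matching_assemble _ _).
    move=> s; rewrite xE !ffunE.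
    rewrite block_disc_internal => uB; rewrite block_disc_internal.
    move: uB; have [->|_] := eqVneq s.1.1 i; last by rewrite mul0r.
    by move/eqP; rewrite mulf_eq0 (negbTE ui0) => /eqP->; rewrite mulr0.
  have c0 : c != 0.
    apply/eqP => c0; move/ffunP/(_ (triangle_type (i, i1) i2)): iE.
    rewrite c0 scale0r !ffunE /block_disc /= eqxx => /eqP.
    by rewrite oner_eq0.
  exists (inr i); apply: (projectivize_unique (c := c^-1)) => //.
  by rewrite /= iE scalerA mulVf ?scale1r.
pose m := boundary_arcs x (Ordinal k0).
pose y := m^-1 *: x.
have xy : x = m *: y by rewrite /y scalerA mulfV ?scale1r.
have m0 : 0 < m by rewrite lt_def mn0; exact: x0.
have yE : y = assemble 1 (block_params y).
  have -> : 1 = boundary_arcs y (Ordinal k0).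
    by rewrite boundary_arcsZ mulVf.
  apply: assemble_params; first exact: matching_equationsZ.
  by move=> D q /(sx D); rewrite ffunE => ->; rewrite scaler0.
have ry : rigid y by apply/rigidZ => //; rewrite invr_eq0.
have y0 s : 0 <= y s.
  by rewrite ffunE; apply: mulr_ge0 => //; rewrite invr_ge0 ltW.
move: y xy yE ry y0 => y xy yE ry y0.
have corners i :
    exists c : {c | corner_pattern c}, block_params y i = corner (val c).
  have [|p' p'y|c cP ->] := @rigid_corner R (block_params y i);
    last by exists (exist _ c cP).
    by move=> s; have := y0 ((i, s.1), s.2); rewrite {1}yE ffunE; case: s.
  pose d := assemble 0 (fun j => if j == i then p' else (0, 0, 0, 0, 0)).
  have [|c dE] := ry d (matching_assemble _ _).
    move=> [[j D] s]; rewrite {1}yE !ffunE.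
    case: eqP => [->|_]; first exact: p'y.
    by rewrite block_disc_internal mul0r.
  have c0 : c = 0.
    have := congr1 (fun z => boundary_arcs z i) dE.
    rewrite boundary_arcsZ {1}yE !boundary_arcs_assemble mulr1.
    by move=> <-.
  have := congr1 (fun z => block_params z i) dE.
  rewrite block_params_assemble eqxx => ->.
  by rewrite c0 scale0r /block_params !ffunE.
have [c cE] := choice corners.
exists (inl [ffun i => c i]); apply: (projectivize_unique (c := m)) => //.
rewrite {1}xy yE; congr (_ *: assemble _ _); apply: funext => i.
by rewrite cE ffunE.
Qed.

End Pathological.

Lemma card_range_fin (T : finType) U (f : T -> U) :
  injective f -> range f #= `I_#|T|.
Proof.
move=> f_inj; have <- : range (fun i : 'I_#|T| => f (enum_val i)) = range f.
  apply/seteqP; split=> [_ [i _ <-]|_ [t _ <-]]; first by exists (enum_val i).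
  by exists (enum_rank t); rewrite ?enum_rankK.
apply: card_eq_trans (inj_card_eq _) (card_esym card_II).
by move=> i j _ _ /f_inj/enum_val_inj.
Qed.

Theorem lemma7 (R : realType) (k : nat) (hk : (1 <= k)%N) :
  tri_size (pathological k) = (4 * k)%N /\
  vertex_normal_surfaces R (pathological k) #= `I_(17 ^ k + k)%N.
Proof.
split; first by rewrite /tri_size card_prod !card_ord mulnC.
have -> : vertex_normal_surfaces R (pathological k) =
    range (fun t => projectivize (extreme_ray t)).
  apply/seteqP; split=> [x /(vertex_extreme_ray hk)[t ->]|_ [t _ <-]].
    by exists t.
  exact: extreme_ray_vertex.
have <- : #|{: {ffun 'I_k -> {c | corner_pattern c}} + 'I_k}| = (17 ^ k + k)%N.
  by rewrite card_sum card_ffun card_corner_pattern !card_ord.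
exact/card_range_fin/projectivize_extreme_ray_inj.
Qed.
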